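(* Let $n\ge 16$ be even and let $W_{4,n}$ be the $4$-regular Kn\''odel graph. Then $W_{4,n}$ is $\gamma$-critical if and only if (i) $n=26$, or (ii) $n\ge 22$ and $n\equiv 2\pmod{10}$, or (iii) $n\ge 38$ and $n\equiv 8\pmod{10}$.
   Context: For an even integer $n\ge 2$ and $1\le\Delta\le\lfloor\log_2 n\rfloor$, the Kn\''odel graph $W_{\Delta,n}$ is the $\Delta$-regular bipartite graph on the $n$ vertices $(i,j)$, $i\in\{1,2\}$, $0\le j\le n/2-1$, in which for every $j$ the vertex $(1,j)$ is adjacent to the vertices $(2,(j+2^k-1)\bmod (n/2))$ for $k=0,1,\dots,\Delta-1$ (and there are no other edges). A set $D$ of vertices of a graph $G$ is dominating if every vertex not in $D$ is adjacent to a vertex of $D$; $\gamma(G)$ is the minimum size of a dominating set. A graph $G$ is $\gamma$-critical if $\gamma(G-u)<\gamma(G)$ for every vertex $u$ of $G$, where $G-u$ is the graph obtained by deleting $u$. *)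

(* Defs.v *)
From mathcomp Require Import all_boot.
Unset Printing Implicit Defensive.

(* Vertices of the Knoedel graph W_{Delta,n}: pairs (i, j) with i in {1,2}
   encoded as 'I_2 (0 <-> 1, 1 <-> 2) and j in {0, ..., n/2 - 1}. *)
Definition knodel_vertex (n : nat) : finType := ('I_2 * 'I_(n %/ 2))%type.

Definition knodel_arc (Delta n : nat) (x y : knodel_vertex n) : bool :=
  [&& val x.1 == 0, val y.1 == 1 &
      [exists k : 'I_Delta, val y.2 == (val x.2 + 2 ^ k - 1) %% (n %/ 2)]].

Definition knodel_adj (Delta n : nat) : rel (knodel_vertex n) :=
  fun x y => knodel_arc Delta n x y || knodel_arc Delta n y x.

(* Graph notions for a simple graph given by an adjacency relation [e] on a
   finite type, restricted to a vertex set [V] (so that G - u is the graph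
   induced on V :\ u). *)
Section Domination.
Variable T : finType.
Variable e : rel T.

Definition dominating (V D : {set T}) : bool :=
  (D \subset V) &&
  [forall v in V, (v \in D) || [exists w in D, e v w]].

(* domination number of the graph induced on V (V itself dominates V,
   so the minimum is over a nonempty family and is at most #|T|). *)
Definition gamma (V : {set T}) : nat :=
  \big[minn/#|T|]_(D : {set T} | dominating V D) #|D|.

Definition gamma_critical (V : {set T}) : Prop :=
  forall u, u \in V -> gamma (V :\ u) < gamma V.
End Domination.

Definition knodel_gamma_critical (Delta n : nat) : Prop :=
  @gamma_critical (knodel_vertex n) (knodel_adj Delta n) [set: knodel_vertex n].

(* Main.v *)
(* Write m = n / 2. A set D is a closed word of m letters. With W the total
   excess domination (a vertex dominated k > 0 times counts k - 1) and U the
   number of undominated vertices, double counting gives W + 2 m = 5 |D| + U.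
   For U <= 1 and |D| near 2 m / 5 the excess W is at most 7. The perfect code
   (W = U = 0) is unique up to rotation and has period 5, and deviations from it
   are expensive: a finite search from the perfect windows shows that a closed
   walk through such a window with U = 0, W <= 7 has m = 0 or 2 mod 5, the
   latter only if W >= 6, and one with U = 1, W <= 5 has m = 1 mod 5. By the
   cycle lemma a closed walk has a rotation all of whose prefixes have at most
   the average cost W + U; a search along such a rotation shows that a perfect
   window occurs as soon as 36 (W + U) <= 7 m and m >= 16, and the few remaining
   lengths are searched individually. The matching sets are explicit words
   extended by perfect blocks of length 5, except for five small values of m.
   For criticality one needs one such set per side of the missing vertex, the
   translations moving it anywhere on that side. *)
Require Import Defs.
From mathcomp Require Import all_boot.
From mathcomp Require Import zify.

(** * Histories and weights *)

(* A set D of vertices is read as the word of letters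
   ((1, i) \in D, (2, i) \in D), i = 0, 1, 2, ...; a history lists the letters
   read so far, most recent first. *)
Definition letter := (bool * bool)%type.
Definition blank : letter := (false, false).

Definition inA (h : seq letter) k : bool := (nth blank h k).1.
Definition inB (h : seq letter) k : bool := (nth blank h k).2.

(* Reading letter i completes the closed neighbourhoods of exactly two
   vertices: (1, i - 7) for [undom1] and (2, i) for [undom2]. *)
Definition undom1 (h : seq letter) : bool :=
  ~~ [|| inA h 7, inB h 7, inB h 6, inB h 4 | inB h 0].

Definition undom2 (h : seq letter) : bool :=
  ~~ [|| inB h 0, inA h 0, inA h 1, inA h 3 | inA h 7].

(* Short histories are those of searches that start with unknown past. *)
Definition undom (h : seq letter) : nat :=
  if size h < 8 then 0 else undom1 h + undom2 h.

(* One unit for each pair of a vertex of D in the head letter and a vertex that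
   it dominates, when the latter is already dominated by an earlier vertex of D
   (within a letter, side 1 comes before side 2). Hence a vertex dominated
   k > 0 times contributes k - 1 in total. *)
Definition weight (h : seq letter) : nat :=
  (inB h 0 && inA h 0) + (inB h 0 && (inA h 1 || inB h 1)) +
  (inB h 0 && [|| inA h 3, inB h 3 | inB h 2]) +
  (inB h 0 && [|| inA h 7, inB h 7, inB h 6 | inB h 4]) +
  (inA h 0 && inA h 4) + (inA h 0 && (inA h 2 || inA h 6)) +
  (inA h 0 && [|| inA h 1, inA h 3 | inA h 7]) +
  (inB h 0 && [|| inA h 0, inA h 1, inA h 3 | inA h 7]).

Definition letters : seq letter :=
  [:: (false, false); (true, false); (false, true); (true, true)].

(** * Pruned searches *)

(* [true] means that along every word [stop] answers [Some true] after at most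
   [n] further letters, before ever answering [Some false]. *)
Fixpoint search (stop : nat -> nat -> seq letter -> option bool) n w d h :=
  if stop w d h is Some b then b else
  if n is n'.+1 then
    all (fun l => let h' := l :: h in
           search stop n' (w + weight h') (d + undom h') h') letters
  else false.

Definition perfect_letter i : letter := (i %% 5 == 0, i %% 5 == 4).

(* The past of a perfect code just after the letter of residue [q]; subtraction
   of k modulo 5 is written as addition of 4 * k. *)
Definition perfect_past q : seq letter :=
  [seq perfect_letter (q + 4 * k) | k <- iota 0 7].

(* Equals 5 when the last seven letters do not come from a perfect code. *)
Definition phase (h : seq letter) : nat :=
  index (take 7 h) [seq perfect_past q | q <- iota 0 5].

Definition budget w d : bool := (d == 0) && (w <= 7) || (d == 1) && (w <= 5).

(* [r] is the number of letters read, modulo 5, corrected by the change of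
   phase, so that it is the total length modulo 5 on a closed walk. *)
Definition admissible r w d : bool :=
  (d == 0) && ((r == 0) || (r == 2) && (6 <= w)) || (d == 1) && (r == 1).

Definition stop_at_return p w d h : option bool :=
  if ~~ budget w d then Some true
  else if (7 < size h) && (phase h < 5) then
    Some (admissible ((size h - 7 + p + 4 * phase h) %% 5) w d)
  else None.

(* Rejects what is not part of a word of period [r], with costs of slope at most
   num / den, avoiding perfect windows; [r = 0] imposes no period. *)
Definition stop_light num den r u w d h : option bool :=
  if [|| u < d, num * size h < den * (w + d),
         (6 < size h) && (phase h < 5)
       | (r < size h) && (nth blank h 0 != nth blank h r)]
  then Some true else None.

(* Triples (m, bound on weight + undominated, bound on undominated) whose slope
   is too steep for [search_long]. *)
Definition closed_cases : seq (nat * nat * nat) :=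
  [:: (8, 1, 1); (11, 3, 0); (12, 3, 1); (13, 4, 0); (14, 4, 1); (19, 7, 0);
      (23, 6, 1); (24, 7, 0); (28, 6, 1); (29, 7, 0); (34, 7, 0)].

Definition light m w d : bool :=
  (16 <= m) && (36 * (w + d) <= 7 * m) ||
  has (fun t => [&& m == t.1.1, w + d <= t.1.2 & d <= t.2]) closed_cases.

Lemma search_return :
  all (fun p => search (stop_at_return p) 40 0 0 (perfect_past p)) (iota 0 5).
Proof. by vm_compute. Qed.

Lemma search_long : search (stop_light 7 36 0 1) 23 0 0 [::].
Proof. by vm_compute. Qed.

Lemma search_closed :
  all (fun t => search (stop_light t.1.2 t.1.1 t.1.1 t.2) (t.1.1 + 7) 0 0 [::])
    closed_cases.
Proof. by vm_compute. Qed.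

Lemma sum_split (j n : nat) (F : nat -> nat) :
  \sum_(0 <= i < j + n) F i =
    \sum_(0 <= i < j) F i + \sum_(0 <= i < n) F (j + i).
Proof.
rewrite (big_cat_nat (n := j)) ?leq_addr //=; congr (_ + _).
rewrite -[X in \sum_(X <= _ < _) _]add0n big_addn addKn.
by apply: eq_bigr => i _; rewrite addnC.
Qed.

Lemma sum_shift (m k : nat) (F : nat -> nat) :
  (forall i, F (i + m) = F i) ->
  \sum_(0 <= i < m) F (i + k) = \sum_(0 <= i < m) F i.
Proof.
move=> perF; elim: k => [|k IHk]; first by under eq_bigr do rewrite addn0.
case: m perF IHk => [|m] perF IHk; first by rewrite !big_nil.
rewrite -IHk big_nat_recr //= [RHS]big_nat_recl //= addnC; congr (_ + _).
  by rewrite -(perF (0 + k)); congr F; lia.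
by apply: eq_bigr => i _; congr F; lia.
Qed.

Lemma sum_periodic (m q r : nat) (F : nat -> nat) :
  (forall i, F (i + m) = F i) ->
  \sum_(0 <= i < q * m + r) F i =
    q * \sum_(0 <= i < m) F i + \sum_(0 <= i < r) F i.
Proof.
move=> perF; elim: q => [|q IHq]; first by rewrite mul0n.
rewrite (big_cat_nat (n := m)) /= ?mulSn; try lia.
rewrite -addnA addnA -[m in X in _ + X]add0n big_addn.
have -> : m + q * m + r - m = q * m + r by lia.
by under [X in _ + X]eq_bigr do rewrite perF; rewrite IHq addnA.
Qed.

(* Cycle lemma: start where the partial sums of [m * f - S] peak. *)
Lemma light_rotation (m : nat) (f : nat -> nat) :
  0 < m -> (forall i, f (i + m) = f i) ->
  exists s, forall j,
    (\sum_(0 <= i < j) f (s + i)) * m <= j * \sum_(0 <= i < m) f i.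
Proof.
move=> m_gt0 perf; set S := \sum_(0 <= i < m) f i.
pose X r := \sum_(0 <= i < r) f i.
pose G (r : 'I_m) := X r * m + (m - r) * S.
case: (@arg_maxnP _ (Ordinal m_gt0) xpredT G) => // s _ maxG.
exists s => j; pose q := (s + j) %/ m; pose r := (s + j) %% m.
have r_lt : r < m by rewrite ltn_mod.
have Esj : s + j = q * m + r by rewrite -divn_eq.
have := maxG (Ordinal r_lt) isT; rewrite /G /=.
have EX : X s + \sum_(0 <= i < j) f (s + i) = q * S + X r.
  by rewrite /X -sum_periodic // -Esj sum_split.
have s_lt := ltn_ord s; move: EX; rewrite -/S => EX Hle.
set Y := \sum_(0 <= i < j) _ in EX *.
have : (X s + Y) * m = (q * S + X r) * m by rewrite EX.
have [Em1 Em2] : (m - r) * S + r * S = m * S /\ (m - s) * S + s * S = m * S.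
  by rewrite -!mulnDl !subnK ?(ltnW r_lt) ?(ltnW s_lt).
have : (s + j) * S = (q * m + r) * S by rewrite Esj.
rewrite !mulnDl => E1 E2.
have E3 : q * S * m = q * m * S by rewrite mulnAC.
lia.
Qed.

Fixpoint hist (c : nat -> letter) s n : seq letter :=
  if n is n'.+1 then c (s + n') :: hist c s n' else [::].

Lemma size_hist c s n : size (hist c s n) = n.
Proof. by elim: n => //= n ->. Qed.

Lemma nth_hist c s n k : k < n -> nth blank (hist c s n) k = c (s + (n - k.+1)).
Proof.
elim: n k => // n IHn [|k] /=; first by rewrite subSS subn0.
by rewrite ltnS => /IHn ->; congr c; lia.
Qed.

Lemma take_hist_shift c s j k :
  take k (hist c s (j + k)) = hist c (s + j) k.
Proof.
apply: (@eq_from_nth _ blank) => [|i].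
  by rewrite size_take !size_hist; case: ifP; lia.
rewrite size_take !size_hist => i_lt.
have {}i_lt : i < k by case: ifP i_lt; lia.
by rewrite nth_take // !nth_hist; [congr c; lia | lia | lia].
Qed.

Lemma hist_periodic c m s n :
  (forall i, c (i + m) = c i) -> hist c (s + m) n = hist c s n.
Proof. by move=> perc; elim: n => //= n ->; rewrite addnAC perc. Qed.

Lemma weight_take h : weight (take 8 h) = weight h.
Proof. by rewrite /weight /inA /inB !nth_take. Qed.

Lemma undom_take h : undom (take 8 h) = undom h.
Proof.
rewrite /undom /undom1 /undom2 /inA /inB size_take !nth_take //.
by case: (ltnP 8 (size h)) => [/ltnW|] Hs; rewrite ?ltnn ?(leq_gtF Hs).
Qed.

Lemma weight_take_le j h : weight (take j h) <= weight h.
Proof.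
have sub (k : nat) : (inA (take j h) k -> inA h k) /\ (inB (take j h) k -> inB h k).
  rewrite /inA /inB; case: (ltnP k j) => [lt_kj|le_jk]; first by rewrite !nth_take.
  by rewrite nth_default // size_take; case: ifP; lia.
have subA k := proj1 (sub k); have subB k := proj2 (sub k).
have leb (x y : bool) : (x -> y) -> x <= y by case: x y => [] [] // /(_ isT).
rewrite /weight; repeat apply: leq_add; apply: leb;
  repeat match goal with
  | |- context [inA (take j h) ?k] =>
      move: (subA k); case: (inA (take j h) k); [move=> /(_ isT) ->|move=> _]
  | |- context [inB (take j h) ?k] =>
      move: (subB k); case: (inB (take j h) k); [move=> /(_ isT) ->|move=> _]
  end; by rewrite /= ?orbT.
Qed.

(** * Soundness of the searches on periodic words *)

Lemma search_sound stop n w d (l : nat -> letter) (H : nat -> seq letter) :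
  (forall j, H j.+1 = l j :: H j) -> search stop n w d (H 0) ->
  let run j := stop (w + \sum_(0 <= i < j) weight (H i.+1))
                    (d + \sum_(0 <= i < j) undom (H i.+1)) (H j) in
  exists j, [/\ j <= n, run j = Some true & forall i, i < j -> run i = None].
Proof.
elim: n w d l H => [|n IHn] w d l H HS /=.
  case E: (stop _ _ _) => [[]|] // _; exists 0; split=> //.
  by rewrite !big_nil !addn0.
case E: (stop _ _ _) => [[]|] //.
  by move=> _; exists 0; split=> //; rewrite !big_nil !addn0.
set b := (X in is_true X) => Hb.
have {b Hb} : search stop n (w + weight (H 1)) (d + undom (H 1)) (H 1).
  by rewrite HS; move: (l 0) Hb => [[] []] /and5P[].
move/(IHn _ _ (fun j => l j.+1) (fun j => H j.+1)) => [j|j [le_jn Ej ltj]].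
  by rewrite HS.
exists j.+1; split=> //.
  by move: Ej; rewrite !(big_nat_recl j) // -!addnA.
case=> [_|i /ltj <-]; first by rewrite !big_nil !addn0.
by rewrite !(big_nat_recl i) // -!addnA.
Qed.

Lemma phase_take h : phase (take 7 h) = phase h.
Proof. by rewrite /phase take_takel. Qed.

Section Periodic.
Variables (m : nat) (c : nat -> letter).
Hypotheses (m_ge8 : 8 <= m) (perc : forall i, c (i + m) = c i).

Definition total_weight := \sum_(0 <= i < m) weight (hist c i 8).
Definition total_undom := \sum_(0 <= i < m) undom (hist c i 8).

Let perh i : hist c (i + m) 8 = hist c i 8. Proof. exact: hist_periodic. Qed.

Lemma window_sum (F : seq letter -> nat) s :
  \sum_(0 <= i < m) F (hist c (s + i) 8) = \sum_(0 <= i < m) F (hist c i 8).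
Proof.
rewrite -(@sum_shift m s (fun i => F (hist c i 8))) => [|i]; last by rewrite perh.
by apply: eq_bigr => i _; rewrite addnC.
Qed.

Lemma hist_shift8 s j : take 8 (hist c s (7 + j).+1) = hist c (s + j) 8.
Proof. by rewrite -[(7 + j).+1]/(8 + j) (addnC 8) take_hist_shift. Qed.

Lemma weight_hist_le s j :
  weight (hist c (s + 7) j.+1) <= weight (hist c (s + j) 8).
Proof.
by rewrite -take_hist_shift addnS -hist_shift8 weight_take weight_take_le.
Qed.

Lemma undom_hist s j :
  undom (hist c (s + 7) j.+1) = if j < 7 then 0 else undom (hist c (s + j) 8).
Proof.
case: ltnP => [lt_j7|]; first by rewrite /undom size_hist ltnS lt_j7.
move=> le_7j; have {1}-> : j.+1 = j - 7 + 8 by lia.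
by rewrite -undom_take take_hist_shift -addnA subnKC.
Qed.

(* Started from an empty history at the rotation of [light_rotation], the search
   sees at most the true weights, so it can only be stopped by a perfect
   window. *)
Lemma light_visits_perfect num den r u n :
  search (stop_light num den r u) n 0 0 [::] ->
  (forall i, c (i + r) = c i) -> n <= m + 7 ->
  (total_weight + total_undom) * den <= num * m -> total_undom <= u ->
  exists s, phase (hist c s 7) < 5.
Proof.
move=> Hs perr le_n le_tot le_u.
have m_gt0 : 0 < m by lia.
have [|s lights] := @light_rotation m
  (fun i => weight (hist c i 8) + undom (hist c i 8)) m_gt0.
  by move=> i; rewrite perh.
have HS j : hist c (s + 7) j.+1 = c (s + 7 + j) :: hist c (s + 7) j by [].
have [j [le_jn Ej _]] := search_sound _ _ _ _ _ _ HS Hs.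
move: Ej; rewrite /stop_light !add0n size_hist.
set W := \sum_(0 <= i < j) weight _; set D := \sum_(0 <= i < j) undom _.
case: ifP => // /or4P[] + _.
- have: D <= total_undom.
    have -> : D = \sum_(0 <= i < j) if i < 7 then 0 else undom (hist c (s + i) 8).
      by apply: eq_bigr => i _; rewrite undom_hist.
    rewrite /total_undom -(window_sum undom (s + 7)).
    case: (leqP j 7) => [le_j7|lt_7j].
      rewrite big1_seq // => i /=; rewrite mem_index_iota => lt_ij.
      by rewrite (leq_trans _ le_j7).
    rewrite (big_cat_nat (n := 7)) ?(ltnW lt_7j) //= big1_seq ?add0n; last first.
      by move=> i /=; rewrite mem_index_iota /= => ->.
    rewrite -{1}[7]add0n big_addn.
    rewrite [leqRHS](big_cat_nat (n := j - 7)) //=; last lia.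
    rewrite -[leqLHS]addn0 leq_add // leq_sum // => i _.
    by rewrite ifN ?addnA ?(addnAC s 7) // -leqNgt leq_addl.
  lia.
- have: (W + D) <= \sum_(0 <= i < j)
      (weight (hist c (s + i) 8) + undom (hist c (s + i) 8)).
    rewrite -big_split /=; apply: leq_sum => i _.
    by rewrite leq_add ?weight_hist_le // undom_hist; case: ifP.
  have:= lights j; rewrite [X in j * X]big_split /=.
  rewrite -/total_weight -/total_undom.
  set X := \sum_(0 <= i < j) _ => le1 le2 lt3.
  suff: den * (W + D) * m <= num * j * m by rewrite leq_pmul2r //; lia.
  apply: (@leq_trans (den * (X * m))).
    by rewrite -mulnA leq_mul2l leq_mul2r le2 !orbT.
  apply: (@leq_trans (den * (j * (total_weight + total_undom)))).
    by rewrite leq_mul2l le1 orbT.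
  by have := leq_mul (leqnn j) le_tot; lia.
- case/andP=> le_7j; rewrite -phase_take -(subnK le_7j) take_hist_shift.
  by exists (s + 7 + (j - 7)).
- case/andP=> lt_rj; rewrite !nth_hist //; last lia.
  by rewrite -(perr (s + 7 + (j - r.+1))) -addnA; case/eqP; congr c; lia.
Qed.

Lemma budget_le w d w' d' : w <= w' -> d <= d' -> budget w' d' -> budget w d.
Proof. by rewrite /budget; lia. Qed.

Lemma admissible_add r1 w1 d1 r2 w2 d2 :
  budget (w1 + w2) (d1 + d2) -> admissible r1 w1 d1 -> admissible r2 w2 d2 ->
  admissible ((r1 + r2) %% 5) (w1 + w2) (d1 + d2).
Proof.
by rewrite /budget /admissible; lia.
Qed.

Lemma perfect_phase h :
  size h = 7 -> phase h < 5 -> h = perfect_past (phase h).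
Proof.
move=> sz_h; rewrite /phase take_oversize ?sz_h // => lt_ph.
have := lt_ph; rewrite -[X in _ < X]/(size [seq perfect_past q | q <- iota 0 5]).
rewrite index_mem => /(nth_index [::]) {1}<-.
by rewrite (nth_map 0) ?size_iota // nth_iota.
Qed.

(* Cut the closed walk at its visits of perfect windows; [search_return] bounds
   each piece. *)
Lemma perfect_admissible s :
  phase (hist c s 7) < 5 -> budget total_weight total_undom ->
  admissible (m %% 5) total_weight total_undom.
Proof.
set p := phase _ => lt_p5 budg.
pose W j := \sum_(0 <= i < j) weight (hist c (s + i) 8).
pose D j := \sum_(0 <= i < j) undom (hist c (s + i) 8).
have EW : W m = total_weight by exact: window_sum.
have ED : D m = total_undom by exact: window_sum.
have Wadd j n : W (j + n) = W j + \sum_(0 <= i < n) weight (hist c (s + j + i) 8).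
  by rewrite /W sum_split; under [X in _ + X]eq_bigr do rewrite addnA.
have Dadd j n : D (j + n) = D j + \sum_(0 <= i < n) undom (hist c (s + j + i) 8).
  by rewrite /D sum_split; under [X in _ + X]eq_bigr do rewrite addnA.
have phase_m : phase (hist c (s + m) 7) = p by rewrite hist_periodic.
suff main k j : m - j <= k -> j <= m -> phase (hist c (s + j) 7) < 5 ->
    admissible ((j + p + 4 * phase (hist c (s + j) 7)) %% 5) (W j) (D j) ->
    admissible ((m + p + 4 * p) %% 5) (W m) (D m).
  have Em : m %% 5 = (m + p + 4 * p) %% 5 by lia.
  rewrite Em -EW -ED; apply: (main m 0); rewrite ?addn0 ?subn0 // -/p /W /D.
  by rewrite !big_nil add0n -mulSn mulnC modnMl.
elim: k j => [|k IHk] j le_k le_jm; last first.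
  have [->|ne_jm] := eqVneq j m; first by rewrite phase_m.
  have lt_jm : j < m by rewrite ltn_neqAle ne_jm.
  set q := phase (hist c (s + j) 7) => lt_q5 adm_j.
  have Sq : search (stop_at_return q) 40 0 0 (hist c (s + j) 7).
    rewrite [hist _ _ _]perfect_phase ?size_hist // -/q.
    by move/allP: search_return; apply; rewrite mem_iota.
  have HS i : hist c (s + j) (7 + i).+1 = c (s + j + (7 + i)) :: hist c (s + j) (7 + i).
    by [].
  have {Sq} [n] := search_sound _ _ _ _ _ (fun i => hist c (s + j) (7 + i)) HS Sq.
  have EH i : take 7 (hist c (s + j) (7 + i)) = hist c (s + (j + i)) 7.
    by rewrite (addnC 7) take_hist_shift addnA.
  rewrite !add0n; case=> _ + before.
  have le_nm : j + n <= m.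
    rewrite leqNgt; apply/negP => gt_m; have /before : m - j < n by lia.
    rewrite /stop_at_return; case: ifP => // _; rewrite size_hist.
    by rewrite -phase_take EH subnKC // phase_m lt_p5 ifT //; lia.
  have sumW : \sum_(0 <= i < n) weight (hist c (s + j) (7 + i.+1)) =
      \sum_(0 <= i < n) weight (hist c (s + j + i) 8).
    by apply: eq_bigr => i _; rewrite -weight_take addnS hist_shift8.
  have sumD : \sum_(0 <= i < n) undom (hist c (s + j) (7 + i.+1)) =
      \sum_(0 <= i < n) undom (hist c (s + j + i) 8).
    by apply: eq_bigr => i _; rewrite -undom_take addnS hist_shift8.
  rewrite /stop_at_return sumW sumD.
  have := Wadd j n; have := Dadd j n.
  set w := \sum_(0 <= i < n) _; set d := \sum_(0 <= i < n) _ => ED' EW'.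
  have := Wadd (j + n) (m - (j + n)); have := Dadd (j + n) (m - (j + n)).
  rewrite subnKC // => EDm EWm.
  have budg_jn : budget (W (j + n)) (D (j + n)).
    by apply: budget_le budg; rewrite -?EW -?ED ?EDm ?EWm leq_addr.
  rewrite ifN; last first.
    by rewrite negbK; apply: budget_le budg_jn; rewrite ?EW' ?ED' leq_addl.
  rewrite size_hist -phase_take EH; case: ifP => // /andP[lt_7n lt_q'] [adm_n].
  apply: (IHk (j + n)) => //; first lia.
  rewrite EW' ED'.
  have -> : (j + n + p + 4 * phase (hist c (s + (j + n)) 7)) %% 5 =
     ((j + p + 4 * q) %% 5 +
      (7 + n - 7 + q + 4 * phase (hist c (s + (j + n)) 7)) %% 5) %% 5 by lia.
  by apply: admissible_add; rewrite -?EW' -?ED'.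
have -> : j = m by lia.
by rewrite phase_m.
Qed.

Lemma light_admissible :
  light m total_weight total_undom -> budget total_weight total_undom ->
  admissible (m %% 5) total_weight total_undom.
Proof.
move=> Hm budg; have [s Ps] : exists s, phase (hist c s 7) < 5; last first.
  exact: perfect_admissible Ps budg.
case/orP: Hm => [/andP[m_ge16 le_tot]|/hasP[[[m' t] u] t_in /and3P[/eqP Em le_t le_u]]].
  apply: light_visits_perfect search_long _ _ _ _; rewrite ?addn0 //; try lia.
    by move=> i; rewrite addn0.
  by move: budg; rewrite /budget; lia.
have /light_visits_perfect := allP search_closed _ t_in; apply.
- by rewrite -Em.
- by rewrite -Em.
- by rewrite -Em leq_mul2r le_t orbT.
- exact: le_u.
Qed.

End Periodic.

(** * Periodic words with given statistics *)

Definition count_letters (u : seq letter) : nat :=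
  sumn [seq l.1 + l.2 | l : letter <- u].

Lemma weight_total m c : (forall i, c (i + m) = c i) ->
  total_weight m c + 2 * m =
    5 * \sum_(0 <= i < m) ((c i).1 + (c i).2) + total_undom m c.
Proof.
move=> perc; pose a i := (c i).1; pose b i := (c i).2.
have EA i k : k < 8 -> inA (hist c i 8) k = a (i + (8 - k.+1)).
  by move=> k_lt; rewrite /inA nth_hist.
have EB i k : k < 8 -> inB (hist c i 8) k = b (i + (8 - k.+1)).
  by move=> k_lt; rewrite /inB nth_hist.
have pera i : a (i + m) = a i by rewrite /a perc.
have perb i : b (i + m) = b i by rewrite /b perc.
(* The summands of [weight], anchored at the index i of the vertex dominated
   again: (1, i) for [T1] to [T4], (2, i + 7) for [T5] to [T8]. *)
pose T1 i : nat := b i && a i.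
pose T2 i : nat := b (i + 1) && (a i || b i).
pose T3 i : nat := b (i + 3) && [|| a i, b i | b (i + 1)].
pose T4 i : nat := b (i + 7) && [|| a i, b i, b (i + 1) | b (i + 3)].
pose T5 i : nat := a (i + 4) && a i.
pose T6 i : nat := a (i + 6) && (a (i + 4) || a i).
pose T7 i : nat := a (i + 7) && [|| a (i + 6), a (i + 4) | a i].
pose T8 i : nat := b (i + 7) && [|| a (i + 7), a (i + 6), a (i + 4) | a i].
have Ew i : weight (hist c i 8) = T1 (i + 7) + T2 (i + 6) + T3 (i + 4) + T4 i +
    T5 (i + 3) + T6 (i + 1) + T7 i + T8 i.
  by rewrite /weight !EA // !EB // /T1 /T2 /T3 /T4 /T5 /T6 /T7 /T8 subnn addn0 -!addnA.
have shift k (F : nat -> nat) : (forall i, F (i + m) = F i) ->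
  \sum_(0 <= i < m) F (i + k) = \sum_(0 <= i < m) F i by exact: sum_shift.
have perab k i : (a (i + m + k) = a (i + k)) * (b (i + m + k) = b (i + k)).
  by rewrite addnAC pera perb.
have Eu i : undom (hist c i 8) = ~~ [|| a i, b i, b (i + 1), b (i + 3) | b (i + 7)] +
    ~~ [|| b (i + 7), a (i + 7), a (i + 6), a (i + 4) | a i].
  by rewrite /undom size_hist ltnn /undom1 /undom2 !EA // !EB // subnn addn0.
rewrite /total_weight /total_undom (eq_bigr _ (fun i _ => Ew i)).
rewrite [in RHS](eq_bigr _ (fun i _ => Eu i)) !big_split /=.
rewrite (shift 7 T1) ?(shift 6 T2) ?(shift 4 T3) ?(shift 3 T5) ?(shift 1 T6);
  try by move=> i; rewrite /T1 /T2 /T3 /T5 /T6 ?perab ?pera ?perb.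
have sa k : \sum_(0 <= i < m) (a (i + k) : nat) = \sum_(0 <= i < m) (a i : nat).
  by apply: (shift k (fun i => a i : nat)) => i; rewrite pera.
have sb k : \sum_(0 <= i < m) (b (i + k) : nat) = \sum_(0 <= i < m) (b i : nat).
  by apply: (shift k (fun i => b i : nat)) => i; rewrite perb.
pose N i := (a i + b i + b (i + 1) + b (i + 3) + b (i + 7)) +
   (a i + a (i + 4) + a (i + 6) + a (i + 7) + b (i + 7)).
have EN : \sum_(0 <= i < m) N i =
    5 * (\sum_(0 <= i < m) (a i : nat) + \sum_(0 <= i < m) (b i : nat)).
  by rewrite /N !big_split /= !sa !sb; lia.
rewrite -EN.
have -> : 2 * m = \sum_(0 <= i < m) 2 by rewrite sum_nat_const_nat subn0 mulnC.
rewrite -!big_split /=; apply: eq_bigr => i _.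
rewrite /T1 /T2 /T3 /T4 /T5 /T6 /T7 /T8 /N.
by case: (a i); case: (b i); case: (b (i + 1)); case: (b (i + 3)); case: (b (i + 7));
  case: (a (i + 4)); case: (a (i + 6)); case: (a (i + 7)).
Qed.

Fixpoint count_along (F : seq letter -> nat) h (u : seq letter) : nat :=
  if u is l :: u' then F (l :: h) + count_along F (l :: h) u' else 0.

Section Count.
Variable F : seq letter -> nat.
Hypothesis F_take : forall h, F (take 8 h) = F h.

Lemma count_along_take h u : count_along F (take 7 h) u = count_along F h u.
Proof.
suff gen h' : take 7 h' = take 7 h -> count_along F h' u = count_along F h u.
  by apply: gen; rewrite take_takel.
elim: u h h' => //= l u IHu h h' Eh; congr (_ + _).
  by rewrite -[LHS]F_take -[RHS]F_take /= Eh.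
apply: IHu; have := congr1 (take 6) Eh; rewrite !take_takel //.
by move=> E; rewrite /= E.
Qed.

Lemma count_along_cat h u v :
  count_along F h (u ++ v) = count_along F h u + count_along F (catrev u h) v.
Proof. by elim: u h => //= l u IHu h; rewrite IHu addnA. Qed.

Lemma count_along_hist c s n v :
  (forall i, i < size v -> nth blank v i = c (s + n + i)) ->
  count_along F (hist c s n) v =
    \sum_(0 <= i < size v) F (hist c s (n + i).+1).
Proof.
elim: v n => [|l v IHv] n Ev /=; first by rewrite big_nil.
rewrite big_nat_recl //= addn0; have := Ev 0 isT; rewrite /= addn0 => El.
rewrite El -[_ :: _]/(hist c s n.+1) IHv => [|i i_lt].
  by congr (_ + _); apply: eq_bigr => i _; rewrite addnS.
by rewrite -[LHS]/(nth blank (l :: v) i.+1) Ev //; congr c; lia.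
Qed.

End Count.

Lemma undom1_take h : undom1 (take 8 h) = undom1 h.
Proof. by rewrite /undom1 /inA /inB !nth_take. Qed.

Lemma undom2_take h : undom2 (take 8 h) = undom2 h.
Proof. by rewrite /undom2 /inA /inB !nth_take. Qed.

Definition realizes (c : nat -> letter) (m s d1 d2 : nat) : Prop :=
  [/\ forall i, c (i + m) = c i,
      \sum_(0 <= i < m) ((c i).1 + (c i).2) = s,
      \sum_(0 <= i < m) undom1 (hist c i 8) = d1
    & \sum_(0 <= i < m) undom2 (hist c i 8) = d2].

Lemma periodic_mod (c : nat -> letter) m i :
  (forall i, c (i + m) = c i) -> c (i %% m) = c i.
Proof.
move=> perc; rewrite {2}(divn_eq i m) addnC.
by elim: (i %/ m) => [|q IHq]; rewrite ?addn0 // mulSn addnCA addnC perc.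
Qed.

Lemma word_realizes u : 7 <= size u ->
  let h := take 7 (rev u) in
  exists c, realizes c (size u) (count_letters u)
    (count_along undom1 h u) (count_along undom2 h u).
Proof.
set m := size u => m_ge7 h; pose c i := nth blank u (i %% m).
have perc i : c (i + m) = c i by rewrite /c modnDr.
have Eh : h = hist c (m - 7) 7.
  apply: (@eq_from_nth _ blank) => [|i].
    by rewrite size_hist size_takel // size_rev.
  rewrite size_takel ?size_rev // => i_lt7.
  rewrite nth_take // nth_hist // nth_rev; last by rewrite (leq_trans i_lt7).
  rewrite /c modn_small; first by congr nth; rewrite -/m; lia.
  by lia.
have along (F : seq letter -> nat) : (forall h, F (take 8 h) = F h) ->
    \sum_(0 <= i < m) F (hist c i 8) = count_along F h u.
  move=> F_take; rewrite Eh count_along_hist => [|i i_lt].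
    rewrite -(window_sum m c perc F (m - 7)); apply: eq_bigr => i _.
    by rewrite -[RHS]F_take hist_shift8.
  by rewrite subnK // /c modnDl modn_small.
exists c; split=> //.
- rewrite /count_letters sumnE big_map (big_nth blank) -/m big_nat [RHS]big_nat.
  by apply: eq_bigr => i /andP[_ i_lt]; rewrite /c modn_small.
- by apply: along => h'; rewrite undom1_take.
- by apply: along => h'; rewrite undom2_take.
Qed.

(* Continues a perfect code after phase 3. *)
Definition perfect_block : seq letter :=
  [:: (false, true); (true, false); blank; blank; blank].

Lemma perfect_block_family v t :
  take 7 (rev v) = perfect_past 3 -> 7 <= size v ->
  exists c, realizes c (size v + 5 * t) (count_letters v + 2 * t)
    (count_along undom1 (perfect_past 3) v)
    (count_along undom2 (perfect_past 3) v).
Proof.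
move=> Ev v_ge7; pose w := flatten (nseq t perfect_block) ++ v.
have size_w : size w = size v + 5 * t.
  rewrite /w size_cat; elim: (t) => [|k IHk] /=; first by rewrite addn0.
  by lia.
have count_w : count_letters w = count_letters v + 2 * t.
  rewrite /w /count_letters; elim: (t) => [|k IHk] /=; first by rewrite addn0.
  by rewrite IHk; lia.
have take_w : take 7 (rev w) = perfect_past 3.
  by rewrite /w rev_cat takel_cat ?size_rev.
have along (F : seq letter -> nat) : (forall h, F (take 8 h) = F h) ->
    count_along F (perfect_past 3) perfect_block = 0 ->
    count_along F (perfect_past 3) w = count_along F (perfect_past 3) v.
  move=> F_take F_block; rewrite /w; elim: (t) => [//|k IHk].
  rewrite -[flatten _]/(perfect_block ++ flatten (nseq k perfect_block)).
  rewrite -catA count_along_cat F_block -[RHS]IHk.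
  by rewrite -(count_along_take F F_take (catrev _ _)).
have [|c] := @word_realizes w; first by rewrite size_w ltn_addr.
rewrite take_w size_w count_w !along => [|h|//|h|//]; first by exists c.
  by rewrite undom2_take.
by rewrite undom1_take.
Qed.

(* 1 and 2 stand for the vertex of that side alone, 0 for no vertex. *)
Definition word (code : seq nat) : seq letter :=
  [seq (l == 1, l == 2) | l <- code].

Lemma family_realizes v k l t m s d1 d2 :
  take 7 (rev v) = perfect_past 3 -> 7 <= size v ->
  size v = k -> count_letters v = l ->
  count_along undom1 (perfect_past 3) v = d1 ->
  count_along undom2 (perfect_past 3) v = d2 ->
  m = k + 5 * t -> s = l + 2 * t ->
  exists c, realizes c m s d1 d2.
Proof. by move=> Ev v_ge7 <- <- <- <- -> ->; apply: perfect_block_family. Qed.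

Lemma single_realizes v m s d1 d2 :
  7 <= size v -> size v = m -> count_letters v = s ->
  count_along undom1 (take 7 (rev v)) v = d1 ->
  count_along undom2 (take 7 (rev v)) v = d2 ->
  exists c, realizes c m s d1 d2.
Proof. by move=> v_ge7 <- <- <- <-; apply: word_realizes. Qed.

(** * Domination in Knoedel graphs *)

Section Gamma.
Variables (T : finType) (e : rel T).

Lemma gamma_le (V D : {set T}) : dominating T e V D -> gamma T e V <= #|D|.
Proof.
rewrite /gamma => domD; have := mem_index_enum D.
elim: (index_enum _) => // D' s IHs; rewrite big_cons inE.
case/predU1P => [<-|/IHs le_s]; first by rewrite domD geq_minl.
by case: ifP => // _; rewrite (leq_trans (geq_minr _ _)).
Qed.

Lemma gamma_ge (V : {set T}) k :
  (forall D, dominating T e V D -> k <= #|D|) -> k <= gamma T e V.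
Proof.
move=> le_k; have leV : k <= #|V|.
  apply: le_k; rewrite /dominating subxx.
  by apply/forall_inP => v ->.
rewrite /gamma; apply: (big_ind (fun g => k <= g)) => //.
  exact: leq_trans leV (max_card _).
by move=> x y; rewrite leq_min => -> ->.
Qed.

Definition undominated (D : {set T}) : {set T} :=
  [set v | ~~ ((v \in D) || [exists w in D, e v w])].

Lemma dominating_undominated (V D : {set T}) :
  dominating T e V D = (D \subset V) && (undominated D \subset ~: V).
Proof.
congr (_ && _); apply/forall_inP/subsetP => domD v.
  by rewrite !inE; apply: contra => /domD.
move=> vV; apply: contraTT vV => undom_v.
by have := domD v; rewrite !inE undom_v => /(_ isT).
Qed.

End Gamma.

Arguments undominated {T} e D.

Section Configuration.
Variable n : nat.
Let m := n %/ 2.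
Hypothesis m_ge8 : 8 <= m.
Let T := knodel_vertex n.
Let e : rel T := knodel_adj 4 n.

Let m_gt0 : 0 < m. Proof. by lia. Qed.
Let side0 : 'I_2 := ord0.
Let side1 : 'I_2 := ord_max.
Definition vertex (s : 'I_2) i : T := (s, Ordinal (ltn_pmod i m_gt0)).

Lemma vertex_modm s i j : i = j %[mod m] -> vertex s i = vertex s j.
Proof. by move=> Eij; congr (_, _); apply: val_inj. Qed.

Lemma card_vertex_set (A : {set T}) :
  #|A| = \sum_(0 <= i < m) ((vertex side0 i \in A) + (vertex side1 i \in A)).
Proof.
have -> : #|A| = \sum_(p : 'I_2 * 'I_m) (((p.1, p.2) : T) \in A : nat).
  by rewrite -sum1_card big_mkcond /=; apply: eq_bigr => [[s i]] _ /=; case: ifP.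
rewrite -(pair_bigA _ (fun s i => ((s, i) : T) \in A : nat)) /=.
rewrite big_split /= !big_mkord !big_ord_recl big_ord0 addn0.
by congr (_ + _); apply: eq_bigr => i _; congr (nat_of_bool (_ \in A));
  apply/eqP; rewrite xpair_eqE -!val_eqE /= modn_small ?eqxx.
Qed.

Definition config_of (D : {set T}) i : letter :=
  (vertex side0 i \in D, vertex side1 i \in D).

Lemma config_of_periodic D i : config_of D (i + m) = config_of D i.
Proof. by rewrite /config_of !(vertex_modm _ (i + m) i) ?modnDr. Qed.

Lemma knodel_arcP i j :
  reflect (exists2 k, k \in [:: 0; 1; 3; 7] & j = i + k %[mod m])
    (knodel_arc 4 n (vertex side0 i) (vertex side1 j)).
Proof.
rewrite /knodel_arc /=; apply: (iffP existsP) => [[k /eqP ->]|[k k_in Ej]].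
  exists (2 ^ k - 1); first by case: k => [[|[|[|[|]]]]].
  by rewrite -/m -addnBA ?expn_gt0 // modnDml.
have [x Ex] : exists x : 'I_4, 2 ^ x - 1 = k.
  move: k_in; rewrite !inE; case/or4P => /eqP ->.
  - by exists (@Ordinal 4 0 isT).
  - by exists (@Ordinal 4 1 isT).
  - by exists (@Ordinal 4 2 isT).
  - by exists (@Ordinal 4 3 isT).
by exists x; rewrite -addnBA ?expn_gt0 // Ex -/m modnDml Ej.
Qed.

Lemma vertex_cases (v : T) :
  exists2 i, i < m & v = vertex side0 i \/ v = vertex side1 i.
Proof.
case: v => s [i i_lt]; exists i => //.
by case: s => [[|[|s]] Hs] //; [left | right]; apply/eqP;
  rewrite xpair_eqE -!val_eqE /= modn_small ?eqxx.
Qed.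

Lemma undominated1 D i :
  (vertex side0 i \in undominated e D) = undom1 (hist (config_of D) i 8).
Proof.
have -> : (vertex side0 i \in undominated e D) =
    ~~ ((vertex side0 i \in D) ||
        has (fun k => vertex side1 (i + k) \in D) [:: 0; 1; 3; 7]).
  rewrite inE; congr (~~ (_ || _)); apply/exists_inP/hasP => [[w wD]|[k k_in wD]].
    case: (vertex_cases w) wD => j _ [] -> wD; rewrite /e /knodel_adj orbC //=.
    case/knodel_arcP => k k_in Ej; exists k => //.
    by rewrite -(vertex_modm _ _ _ Ej).
  exists (vertex side1 (i + k)) => //; rewrite /e /knodel_adj.
  by apply/orP; left; apply/knodel_arcP; exists k.
rewrite /undom1 /inA /inB !nth_hist // subnn addn0 /= addn0 orbF.
by congr (~~ _); do 3!case: (_ \in D).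
Qed.

Lemma undominated2 D i :
  (vertex side1 (i + 7) \in undominated e D) = undom2 (hist (config_of D) i 8).
Proof.
have -> : (vertex side1 (i + 7) \in undominated e D) =
    ~~ ((vertex side1 (i + 7) \in D) ||
        has (fun k => vertex side0 (i + (7 - k)) \in D) [:: 0; 1; 3; 7]).
  rewrite inE; congr (~~ (_ || _)); apply/exists_inP/hasP => [[w wD]|[k k_in wD]].
    case: (vertex_cases w) wD => j _ [] -> wD; rewrite /e /knodel_adj //=.
    case/knodel_arcP => k k_in Ej; exists k => //.
    rewrite (vertex_modm _ _ j) //; apply/eqP; rewrite -(eqn_modDr k) -Ej.
    by move: k_in; rewrite !inE => /or4P[] /eqP ->; rewrite -addnA.
  exists (vertex side0 (i + (7 - k))) => //; rewrite /e /knodel_adj.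
  apply/orP; right; apply/knodel_arcP; exists k => //.
  by move: k_in; rewrite !inE => /or4P[] /eqP ->; rewrite -addnA.
rewrite /undom2 /inA /inB !nth_hist // subnn /= !orbF.
by congr (~~ _); do 3!case: (_ \in D).
Qed.

Lemma card_undominated1 D :
  \sum_(0 <= i < m) undom1 (hist (config_of D) i 8) =
  \sum_(0 <= i < m) (vertex side0 i \in undominated e D).
Proof. by apply: eq_bigr => i _; rewrite undominated1. Qed.

Lemma card_undominated2 D :
  \sum_(0 <= i < m) undom2 (hist (config_of D) i 8) =
  \sum_(0 <= i < m) (vertex side1 i \in undominated e D).
Proof.
rewrite -(sum_shift m 7 (fun i => vertex side1 i \in undominated e D)).
  by apply: eq_bigr => i _; rewrite undominated2.
by move=> i; rewrite (vertex_modm _ (i + m) i) ?modnDr.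
Qed.

Lemma undominated_admissible (D : {set T}) :
  #|undominated e D| <= 1 ->
  exists2 w, w + 2 * m = 5 * #|D| + #|undominated e D| &
    light m w #|undominated e D| -> budget w #|undominated e D| ->
    admissible (m %% 5) w #|undominated e D|.
Proof.
set U := #|_| => U_le1; have perD := config_of_periodic D.
have EU : total_undom m (config_of D) = U.
  rewrite /U card_vertex_set big_split /= -card_undominated1 -card_undominated2.
  rewrite -big_split /total_undom; apply: eq_bigr => i _.
  by rewrite /undom size_hist.
exists (total_weight m (config_of D)).
  by rewrite weight_total // EU card_vertex_set.
by rewrite -EU; apply: light_admissible.
Qed.

Lemma eq_hist (c c' : nat -> letter) i k : c =1 c' -> hist c i k = hist c' i k.
Proof. by move=> Ec; elim: k => //= k ->; rewrite Ec. Qed.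

Lemma eq_hist_shift c i k l :
  hist (fun i => c (i + k)) i l = hist c (i + k) l.
Proof. by elim: l => //= l ->; rewrite addnAC. Qed.

Lemma realizes_shift c s d1 d2 k : realizes c m s d1 d2 ->
  realizes (fun i => c (i + k)) m s d1 d2.
Proof.
case=> perc Es E1 E2.
split=> [i|||].
- by rewrite addnAC perc.
- by rewrite -Es (sum_shift m k (fun i => (c i).1 + (c i).2)) // => i; rewrite perc.
- rewrite -E1 -(sum_shift m k (fun i => undom1 (hist c i 8))) => [|i].
    by apply: eq_bigr => i _; rewrite eq_hist_shift.
  by rewrite hist_periodic.
- rewrite -E2 -(sum_shift m k (fun i => undom2 (hist c i 8))) => [|i].
    by apply: eq_bigr => i _; rewrite eq_hist_shift.
  by rewrite hist_periodic.
Qed.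

Lemma realizes_set c s d1 d2 : realizes c m s d1 d2 ->
  exists D : {set T}, [/\ #|D| = s, #|undominated e D| = d1 + d2 & config_of D =1 c].
Proof.
case=> perc Es E1 E2.
pose D := [set v : T | if v.1 == side0 then (c v.2).1 else (c v.2).2].
have ED : config_of D =1 c.
  by move=> i; rewrite /config_of !inE /= (periodic_mod _ _ _ perc) -surjective_pairing.
exists D; split=> //.
  by rewrite card_vertex_set -Es; apply: eq_bigr => i _; rewrite -!ED.
rewrite card_vertex_set big_split /= -card_undominated1 -card_undominated2 -E1 -E2.
by congr (_ + _); apply: eq_bigr => i _; rewrite (eq_hist _ _ _ _ ED).
Qed.

Lemma sum1_ex (F : nat -> bool) : \sum_(0 <= i < m) F i = 1 -> exists i, F i.
Proof.
case: (boolP (has F (index_iota 0 m))) => [/hasP[i _ Fi] _|/hasPn noF].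
  by exists i.
by rewrite big_seq big1 // => i /noF /negbTE ->.
Qed.

Lemma dominating_but_one (D : {set T}) u :
  u \in undominated e D -> #|undominated e D| = 1 ->
  dominating T e ([set: T] :\ u) D.
Proof.
move=> uU /eqP/cards1P[v EU]; have Euv : u = v by apply/set1P; rewrite -EU.
rewrite dominating_undominated EU subsetD1 subsetT setTD setCK Euv subxx andbT /=.
by move: uU; rewrite inE negb_or Euv => /andP[].
Qed.

Lemma realizes_critical s c1 c2 :
  realizes c1 m s 1 0 -> realizes c2 m s 0 1 ->
  (forall D : {set T}, #|undominated e D| = 0 -> s < #|D|) ->
  gamma_critical T e [set: T].
Proof.
move=> R1 R2 lt_s u _.
apply: (@leq_ltn_trans s); last first.
  apply: gamma_ge => D; rewrite dominating_undominated => /andP[_].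
  rewrite setCT subset0 => /eqP ED; apply: lt_s.
  by rewrite ED cards0.
suff [D <- [uU cardU]] : exists2 D : {set T}, #|D| = s &
    u \in undominated e D /\ #|undominated e D| = 1.
  exact: gamma_le (dominating_but_one D u uU cardU).
have [j j_lt [->|->]] := vertex_cases u.
  case: (R1) => perc1 _ /sum1_ex[i0 Hi0] _.
  have [D [cardD undomD ED]] := realizes_set _ _ _ _ (realizes_shift _ _ _ _ (i0 + m - j) R1).
  exists D => //; split=> //; rewrite undominated1 (eq_hist _ _ _ _ ED).
  by rewrite eq_hist_shift subnKC ?hist_periodic //; lia.
case: (R2) => perc2 _ _ /sum1_ex[i0 Hi0].
have [D [cardD undomD ED]] := realizes_set _ _ _ _
  (realizes_shift _ _ _ _ (i0 + m + m - (j + m - 7)) R2).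
exists D => //; split=> //.
rewrite -(vertex_modm _ (j + m - 7 + 7)); last by rewrite subnK ?modnDr //; lia.
rewrite undominated2 (eq_hist _ _ _ _ ED) eq_hist_shift subnKC; last lia.
by rewrite !hist_periodic.
Qed.

Lemma realizes_not_critical s c :
  realizes c m s 0 0 -> (forall D : {set T}, #|undominated e D| <= 1 -> s <= #|D|) ->
  ~ gamma_critical T e [set: T].
Proof.
move=> /realizes_set[D [cardD undomD _]] le_s crit.
have := crit (vertex side0 0) (in_setT _); rewrite ltnNge => /negP; apply.
apply: (@leq_trans s).
  rewrite -cardD; apply: gamma_le; rewrite dominating_undominated subsetT.
  by rewrite (cards0_eq undomD) sub0set.
apply: gamma_ge => D'; rewrite dominating_undominated => /andP[_ subU].
apply: le_s; rewrite -(cards1 (vertex side0 0)); apply: subset_leq_card.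
by rewrite setTD setCK in subU.
Qed.

Lemma light_large k w d : 16 <= k -> 36 * (w + d) <= 7 * k -> light k w d.
Proof. by rewrite /light => -> ->. Qed.

Lemma light_closed k tot u w d : (k, tot, u) \in closed_cases ->
  w + d <= tot -> d <= u -> light k w d.
Proof.
move=> t_in le_tot le_u; apply/orP; right; apply/hasP; exists (k, tot, u) => //=.
by rewrite eqxx le_tot.
Qed.

(** * Lower bounds *)

Lemma size_bound_mod0 D : m %% 5 = 0 -> #|undominated e D| <= 1 ->
  2 * (m %/ 5) <= #|D|.
Proof.
move=> H0 HU; have [|w Ew] := undominated_admissible D; first by rewrite ?HU.
by move=> _; lia.
Qed.

Lemma size_bound_mod1 D : m %% 5 = 1 -> #|undominated e D| = 0 ->
  2 * (m %/ 5) + 1 < #|D|.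
Proof.
move=> H0 HU; have [|w Ew] := undominated_admissible D; first by rewrite ?HU.
rewrite leqNgt => adm; apply/negP => lt_D.
have L : light m w #|undominated e D|.
  have [Em|?] := eqVneq m 11.
    by rewrite Em; apply: (@light_closed _ 3 0) => //; lia.
  by apply: light_large; lia.
by move: (adm L); rewrite /budget /admissible; lia.
Qed.

Lemma size_bound_mod2 D : m %% 5 = 2 -> #|undominated e D| <= 1 ->
  2 * (m %/ 5) + 2 <= #|D|.
Proof.
move=> H0 HU; have [|w Ew] := undominated_admissible D; first by rewrite ?HU.
rewrite leqNgt => adm; apply/negP => lt_D.
have L : light m w #|undominated e D|.
  have [Em|?] := eqVneq m 12.
    by rewrite Em; apply: (@light_closed _ 3 1) => //; lia.
  by apply: light_large; lia.
by move: (adm L); rewrite /budget /admissible; lia.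
Qed.

Lemma size_bound_mod3 D : m %% 5 = 3 -> 23 <= m -> #|undominated e D| <= 1 ->
  2 * (m %/ 5) + 3 <= #|D|.
Proof.
move=> H0 H1 HU; have [|w Ew] := undominated_admissible D; first by rewrite ?HU.
rewrite leqNgt => adm; apply/negP => lt_D.
have L : light m w #|undominated e D|.
  have [Em|?] := eqVneq m 23.
    by rewrite Em; apply: (@light_closed _ 6 1) => //; lia.
  have [Em|?] := eqVneq m 28.
    by rewrite Em; apply: (@light_closed _ 6 1) => //; lia.
  by apply: light_large; lia.
by move: (adm L); rewrite /budget /admissible; lia.
Qed.

Lemma size_bound_mod4 D : m %% 5 = 4 -> 19 <= m -> #|undominated e D| = 0 ->
  2 * (m %/ 5) + 3 < #|D|.
Proof.
move=> H0 H1 HU; have [|w Ew] := undominated_admissible D; first by rewrite ?HU.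
rewrite leqNgt => adm; apply/negP => lt_D.
have L : light m w #|undominated e D|.
  have [Em|?] := eqVneq m 19.
    by rewrite Em; apply: (@light_closed _ 7 0) => //; lia.
  have [Em|?] := eqVneq m 24.
    by rewrite Em; apply: (@light_closed _ 7 0) => //; lia.
  have [Em|?] := eqVneq m 29.
    by rewrite Em; apply: (@light_closed _ 7 0) => //; lia.
  have [Em|?] := eqVneq m 34.
    by rewrite Em; apply: (@light_closed _ 7 0) => //; lia.
  by apply: light_large; lia.
by move: (adm L); rewrite /budget /admissible; lia.
Qed.

Lemma size_bound_8 D : m = 8 -> #|undominated e D| <= 1 -> 4 <= #|D|.
Proof.
move=> H0 HU; have [|w Ew] := undominated_admissible D; first by rewrite ?HU.
rewrite leqNgt => adm; apply/negP => lt_D.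
have L : light m w #|undominated e D|.
  by rewrite H0; apply: (@light_closed _ 1 1) => //; lia.
by move: (adm L); rewrite /budget /admissible; lia.
Qed.

Lemma size_bound_9 D : m = 9 -> #|undominated e D| <= 1 -> 4 <= #|D|.
Proof.
move=> H0 HU; have [|w Ew] := undominated_admissible D; first by rewrite ?HU.
by move=> _; lia.
Qed.

Lemma size_bound_13 D : m = 13 -> #|undominated e D| = 0 -> 6 < #|D|.
Proof.
move=> H0 HU; have [|w Ew] := undominated_admissible D; first by rewrite ?HU.
rewrite leqNgt => adm; apply/negP => lt_D.
have L : light m w #|undominated e D|.
  by rewrite H0; apply: (@light_closed _ 4 0) => //; lia.
by move: (adm L); rewrite /budget /admissible; lia.
Qed.

Lemma size_bound_14 D : m = 14 -> #|undominated e D| <= 1 -> 7 <= #|D|.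
Proof.
move=> H0 HU; have [|w Ew] := undominated_admissible D; first by rewrite ?HU.
rewrite leqNgt => adm; apply/negP => lt_D.
have L : light m w #|undominated e D|.
  by rewrite H0; apply: (@light_closed _ 4 1) => //; lia.
by move: (adm L); rewrite /budget /admissible; lia.
Qed.

Lemma size_bound_18 D : m = 18 -> #|undominated e D| <= 1 -> 8 <= #|D|.
Proof.
move=> H0 HU; have [|w Ew] := undominated_admissible D; first by rewrite ?HU.
rewrite leqNgt => adm; apply/negP => lt_D.
have L : light m w #|undominated e D| by apply: light_large; lia.
by move: (adm L); rewrite /budget /admissible; lia.
Qed.

End Configuration.

Theorem theorem4p5 (n : nat) : 16 <= n -> ~~ odd n ->
  (knodel_gamma_critical 4 n <->
   [\/ n = 26,
       22 <= n /\ n %% 10 = 2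
     | 38 <= n /\ n %% 10 = 8]).
Proof.
move=> n_ge16 n_even; pose m := n %/ 2.
have En : n = 2 * m by rewrite /m; lia.
have m_ge8 : 8 <= n %/ 2 by rewrite -/m; lia.
have critical s c1 c2 : realizes c1 m s 1 0 -> realizes c2 m s 0 1 ->
    (forall D, #|undominated (knodel_adj 4 n) D| = 0 -> s < #|D|) ->
    knodel_gamma_critical 4 n by exact: realizes_critical.
have not_critical s c : realizes c m s 0 0 ->
    (forall D, #|undominated (knodel_adj 4 n) D| <= 1 -> s <= #|D|) ->
    ~ knodel_gamma_critical 4 n by exact: realizes_not_critical.
split=> [crit|].
  have [?|ne13] := eqVneq m 13; first by apply: Or31; lia.
  case: (ltngtP (m %% 5) 1) => [m0|m_gt1|m1]; last by apply: Or32; lia.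
    exfalso; have [c Rc] : exists c, realizes c m (2 * (m %/ 5)) 0 0.
      by apply: (@family_realizes (word [:: 2; 1; 0; 0; 0; 2; 1; 0; 0; 0])
        10 4 (m %/ 5 - 2)) => //; lia.
    by apply: (not_critical _ _ Rc) crit => D; apply: size_bound_mod0 => //; lia.
  have [m2|ne2] := eqVneq (m %% 5) 2.
    exfalso; have [c Rc] : exists c, realizes c m (2 * (m %/ 5) + 2) 0 0.
      by apply: (@family_realizes (word [:: 2; 2; 1; 1; 0; 0; 0; 2; 1; 0; 0; 0])
        12 6 (m %/ 5 - 2)) => //; lia.
    by apply: (not_critical _ _ Rc) crit => D; apply: size_bound_mod2.
  have [E8|ne8] := eqVneq m 8.
    exfalso; have [c Rc] : exists c, realizes c m 4 0 0.
      by apply: (@single_realizes (word [:: 1; 1; 0; 0; 0; 2; 2; 0])).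
    by apply: (not_critical _ _ Rc) crit => D; apply: size_bound_8.
  have [E18|ne18] := eqVneq m 18.
    exfalso; have [c Rc] : exists c, realizes c m 8 0 0.
      by apply: (@single_realizes
        (word [:: 1; 0; 0; 0; 2; 2; 0; 0; 1; 1; 0; 0; 0; 2; 2; 0; 0; 1])).
    by apply: (not_critical _ _ Rc) crit => D; apply: size_bound_18.
  have [m3|ne3] := eqVneq (m %% 5) 3.
    exfalso; have [c Rc] : exists c, realizes c m (2 * (m %/ 5) + 3) 0 0.
      by apply: (@family_realizes (word [:: 2; 2; 2; 1; 1; 0; 0; 0; 2; 1; 0; 0; 0])
        13 7 (m %/ 5 - 2)) => //; lia.
    by apply: (not_critical _ _ Rc) crit => D; apply: size_bound_mod3; lia.
  have [E9|ne9] := eqVneq m 9.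
    exfalso; have [c Rc] : exists c, realizes c m 4 0 0.
      by apply: (@single_realizes (word [:: 1; 0; 0; 0; 2; 2; 0; 0; 1])).
    by apply: (not_critical _ _ Rc) crit => D; apply: size_bound_9.
  have [E14|ne14] := eqVneq m 14.
    exfalso; have [c Rc] : exists c, realizes c m 7 0 0.
      by apply: (@single_realizes
        (word [:: 1; 1; 0; 0; 0; 1; 0; 0; 0; 2; 2; 2; 0; 2])).
    by apply: (not_critical _ _ Rc) crit => D; apply: size_bound_14.
  by apply: Or33; lia.
case=> [n26|[n_ge mod2]|[n_ge mod8]].
- have [c1 R1] : exists c, realizes c m 6 1 0.
    by apply: (@single_realizes (word [:: 1; 0; 1; 0; 0; 0; 2; 0; 2; 0; 1; 0; 2]));
      rewrite // /m n26.
  have [c2 R2] : exists c, realizes c m 6 0 1.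
    by apply: (@single_realizes (word [:: 1; 0; 1; 0; 0; 0; 2; 0; 2; 1; 0; 2; 0]));
      rewrite // /m n26.
  by apply: (critical _ _ _ R1 R2) => D; apply: size_bound_13 => //; lia.
- have [c1 R1] : exists c, realizes c m (2 * (m %/ 5) + 1) 1 0.
    by apply: (@family_realizes (word [:: 2; 1; 1; 0; 0; 0; 2; 1; 0; 0; 0])
        11 5 (m %/ 5 - 2)) => //; lia.
  have [c2 R2] : exists c, realizes c m (2 * (m %/ 5) + 1) 0 1.
    by apply: (@family_realizes (word [:: 2; 2; 1; 0; 0; 0; 2; 1; 0; 0; 0])
        11 5 (m %/ 5 - 2)) => //; lia.
  by apply: (critical _ _ _ R1 R2) => D; apply: size_bound_mod1 => //; lia.
- have [c1 R1] : exists c, realizes c m (2 * (m %/ 5) + 3) 1 0.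
    by apply: (@family_realizes (word [:: 2; 2; 2; 0; 1; 1; 0; 0; 0; 2; 1; 0; 0; 0])
        14 7 (m %/ 5 - 2)) => //; lia.
  have [c2 R2] : exists c, realizes c m (2 * (m %/ 5) + 3) 0 1.
    by apply: (@family_realizes (word [:: 2; 2; 0; 0; 2; 1; 1; 0; 0; 2; 1; 0; 0; 0])
        14 7 (m %/ 5 - 2)) => //; lia.
  by apply: (critical _ _ _ R1 R2) => D; apply: size_bound_mod4 => //; lia.
Qed.
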